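(* Let $(u_r)_{r\ge 0}$ be a sequence of complex numbers with $\sum_{r=0}^\infty|u_r|<\infty$, and for $x\in\mathbb{R}$ let \[ f(x)=e^{-x^2/2}\sum_{r=0}^\infty u_r\,e^{-\pi r^2}\cosh\big(\sqrt{2\pi}\,rx\big)\sum_{s=0}^\infty u_s\cos\big(\sqrt{2\pi}\,sx\big), \] \[ g(x)=e^{-x^2/2}\sum_{r=0}^\infty u_r\,e^{-\pi r^2}\sinh\big(\sqrt{2\pi}\,rx\big)\sum_{s=0}^\infty u_s\sin\big(\sqrt{2\pi}\,sx\big). \] Then the cosine Fourier transforms $F_c$ of $f$ and $G_c$ of $g$ satisfy \[ F_c(x)=f(x),\qquad G_c(x)=-g(x). \]
   Context: The cosine Fourier transform of a function $f$ is $F_c(y)=\sqrt{\frac{2}{\pi}}\int_0^\infty f(x)\cos(xy)\,dx$; $G_c$ is defined in the same way from $g$. In the definitions of $f$ and $g$ the right-hand sides are products of $e^{-x^2/2}$ and the two separate series. *)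

(* Defs.v *)
From Stdlib Require Import Reals.
From Coquelicot Require Import Coquelicot.

(* Coquelicot's [Series] is real-valued only.  This is the sum of a complex
   series, total in the same way as [RInt] and [RInt_gen]: it is the limit of
   the partial sums whenever they converge ([CSeries_unique]). *)
Definition CSeries (a : nat -> C) : C :=
  iota (T := C_R_CompleteNormedModule)
    (is_series (V := C_R_NormedModule) a).

Lemma CSeries_unique (a : nat -> C) (l : C) :
  is_series (V := C_R_NormedModule) a l -> CSeries a = l.
Proof.
  exact (iota_filterlim_locally (V := C_R_CompleteNormedModule)
           (F := eventually)
           (sum_n (G := C_R_CompleteNormedModule) a) l).
Qed.

Definition cosine_integrand (f : R -> C) (y : R) : R -> C :=
  fun x => (f x * RtoC (cos (x * y)))%C.

(* The integral over [0, oo) is an improper Riemann integral; [RInt_gen] is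
   unspecified when it diverges, so existence is a separate predicate. *)
Definition ex_cosine_transform (f : R -> C) (y : R) : Prop :=
  ex_RInt_gen (V := C_R_NormedModule) (cosine_integrand f y)
    (at_point 0) (Rbar_locally p_infty).

Definition cosine_transform (f : R -> C) (y : R) : C :=
  (RtoC (sqrt (2 / PI)) *
   RInt_gen (V := C_R_CompleteNormedModule) (cosine_integrand f y)
     (at_point 0) (Rbar_locally p_infty))%C.

Definition f_of (u : nat -> C) (x : R) : C :=
  (RtoC (exp (- x ^ 2 / 2)) *
   CSeries (fun r => u r *
     RtoC (exp (- PI * INR r ^ 2) * cosh (sqrt (2 * PI) * INR r * x))) *
   CSeries (fun s => u s * RtoC (cos (sqrt (2 * PI) * INR s * x))))%C.

Definition g_of (u : nat -> C) (x : R) : C :=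
  (RtoC (exp (- x ^ 2 / 2)) *
   CSeries (fun r => u r *
     RtoC (exp (- PI * INR r ^ 2) * sinh (sqrt (2 * PI) * INR r * x))) *
   CSeries (fun s => u s * RtoC (sin (sqrt (2 * PI) * INR s * x))))%C.

(* Main.v *)
Require Import Defs.
From Stdlib Require Import Reals Lra Lia.
From Coquelicot Require Import Coquelicot.

(** Write [a = sqrt (2 PI) r] and [b = sqrt (2 PI) s], so that
    [exp (- PI r^2) = exp (- a^2 / 2)].  Multiplied out, [f] is the double sum
    of [u r * u s] times the kernel
    [k_rs x = exp (- (x^2 + a^2) / 2) cosh (a x) cos (b x)].  Completing the
    square turns the cosine transform of [k_rs] into Gaussian integrals, and at
    frequency [y] it equals the mean over the two signs of
    [exp (- (b +- y)^2 / 2) cos (a (b +- y))].  Since [a b = 2 PI r s] is a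
    multiple of the period, [cos (a (b +- y)) = cos (a y)], and the mean is
    [exp (- (y^2 + b^2) / 2) cosh (b y) cos (a y) = k_sr y].  The transform
    therefore exchanges [r] and [s] in the kernel, while [u r * u s] is
    symmetric: [f] is its own transform.  With [sinh] and [sin] the same
    computation gives [- k_sr] ([cosh_cos_kernel_value],
    [sinh_sin_kernel_value]), hence the sign for [g].

    The analytic point is to integrate the double series termwise over an
    infinite interval.  The terms do not decay in [x] uniformly in [r], but the
    kernel and its primitive vanishing at 0 are bounded on the whole line
    by constants independent of [r] and [s].  As [u] is absolutely summable, the
    square partial sums of the integrands, and also those of their primitives,
    converge uniformly ([square_sum_uniform]).  The first fact gives the
    integral over each [[0, T]], the second allows letting [T] tend to infinity
    inside the sum ([self_reciprocal]).

    The Gaussian integrals themselves come from two differential identities: one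
    in the upper bound for the total mass ([gauss_mass]) and one in the frequency
    for [exp (- x^2 / 2) cos (c x)] ([gauss_cos_freq_error]). *)

Local Open Scope R_scope.

(** * Truncated Gaussian integrals *)

(** Restates an equation between elements of a carrier of a Coquelicot structure
    in the type [R], where [ring] and [field] find their structure. *)
Ltac as_real := match goal with |- @eq _ ?a ?b => change (@eq R a b) end.

Ltac continuity_2d :=
  repeat first
    [ apply continuity_2d_pt_const
    | apply continuity_2d_pt_id1
    | apply continuity_2d_pt_id2
    | apply continuity_2d_pt_opp
    | apply continuity_2d_pt_plus
    | apply continuity_2d_pt_mult
    | apply (continuity_1d_2d_pt_comp exp);
      [apply derivable_continuous_pt, derivable_pt_exp|]
    | apply (continuity_1d_2d_pt_comp cos);
      [apply derivable_continuous_pt, derivable_pt_cos|]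
    | apply (continuity_1d_2d_pt_comp sin);
      [apply derivable_continuous_pt, derivable_pt_sin|] ].

Definition gauss (x : R) : R := exp (- x ^ 2 / 2).
Definition gauss_cos (c T : R) : R := RInt (fun x => gauss x * cos (c * x)) 0 T.
Definition gauss_sin (c T : R) : R := RInt (fun x => gauss x * sin (c * x)) 0 T.

Lemma continuous_of_derivable (f : R -> R) :
  (forall x, ex_derive f x) -> forall x, continuous f x.
Proof. intros H x; apply (ex_derive_continuous f), H. Qed.

Lemma ex_RInt_of_derivable (f : R -> R) a b :
  (forall x, ex_derive f x) -> ex_RInt f a b.
Proof.
  intros H; apply (ex_RInt_continuous (V := R_CompleteNormedModule)).
  intros x _; apply continuous_of_derivable, H.
Qed.

Lemma is_derive_primitive (f : R -> R) (T : R) :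
  (forall x, ex_derive f x) -> is_derive (fun T => RInt f 0 T) T (f T).
Proof.
  intros H.
  apply (is_derive_RInt f _ 0).
  - apply filter_forall; intros y.
    apply (RInt_correct (V := R_CompleteNormedModule)), ex_RInt_of_derivable, H.
  - apply continuous_of_derivable, H.
Qed.

Lemma ex_derive_gauss_cos_integrand c x : ex_derive (fun x => gauss x * cos (c * x)) x.
Proof. unfold gauss; auto_derive; auto. Qed.

Lemma ex_derive_gauss_sin_integrand c x : ex_derive (fun x => gauss x * sin (c * x)) x.
Proof. unfold gauss; auto_derive; auto. Qed.

Lemma is_derive_gauss_cos (c T : R) :
  is_derive (gauss_cos c) T (gauss T * cos (c * T)).
Proof.
  apply (is_derive_primitive (fun x => gauss x * cos (c * x))).
  apply ex_derive_gauss_cos_integrand.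
Qed.

Lemma is_derive_gauss_sin (c T : R) :
  is_derive (gauss_sin c) T (gauss T * sin (c * T)).
Proof.
  apply (is_derive_primitive (fun x => gauss x * sin (c * x))).
  apply ex_derive_gauss_sin_integrand.
Qed.

Lemma gauss_pos x : 0 < gauss x.
Proof. apply exp_pos. Qed.

Lemma gauss_even x : gauss (- x) = gauss x.
Proof. unfold gauss; f_equal; field. Qed.

Lemma primitive_odd (f : R -> R) T :
  (forall x, ex_derive f x) -> (forall x, f (- x) = f x) ->
  RInt f 0 (- T) = - RInt f 0 T.
Proof.
  intros D E.
  apply is_RInt_unique.
  apply is_RInt_ext with (fun x => - (- f (- x))).
  { intros x _. rewrite E; as_real; ring. }
  apply (is_RInt_opp (V := R_NormedModule) (fun x => - f (- x))).
  apply (is_RInt_comp_opp (V := R_NormedModule)).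
  rewrite Ropp_0, Ropp_involutive.
  apply (RInt_correct (V := R_CompleteNormedModule)), ex_RInt_of_derivable, D.
Qed.

Lemma primitive_even (f : R -> R) T :
  (forall x, ex_derive f x) -> (forall x, f (- x) = - f x) ->
  RInt f 0 (- T) = RInt f 0 T.
Proof.
  intros D E.
  apply is_RInt_unique.
  apply is_RInt_ext with (fun x => - f (- x)).
  { intros x _. rewrite E; as_real; ring. }
  apply (is_RInt_comp_opp (V := R_NormedModule)).
  rewrite Ropp_0, Ropp_involutive.
  apply (RInt_correct (V := R_CompleteNormedModule)), ex_RInt_of_derivable, D.
Qed.

Lemma gauss_cos_odd c T : gauss_cos c (- T) = - gauss_cos c T.
Proof.
  apply (primitive_odd (fun x => gauss x * cos (c * x))).
  - apply ex_derive_gauss_cos_integrand.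
  - intros x. rewrite gauss_even.
    replace (c * - x) with (- (c * x)) by ring. now rewrite cos_neg.
Qed.

Lemma gauss_sin_even c T : gauss_sin c (- T) = gauss_sin c T.
Proof.
  apply (primitive_even (fun x => gauss x * sin (c * x))).
  - apply ex_derive_gauss_sin_integrand.
  - intros x. rewrite gauss_even.
    replace (c * - x) with (- (c * x)) by ring. rewrite sin_neg; ring.
Qed.

(** * The total mass *)

(** The correction term of the classical evaluation of the Gaussian integral: by
    polar coordinates, half the integral of [exp (- (x^2 + z^2) / 2)] over the part of the
    positive quadrant outside the square of side [t]. *)
Definition polar (t : R) : R := RInt (fun x => exp (- t ^ 2 * (1 + x ^ 2) / 2) / (1 + x ^ 2)) 0 1.

Lemma one_plus_sq_pos x : 0 < 1 + x ^ 2.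
Proof. nra. Qed.

Lemma ex_derive_polar_integrand t x :
  ex_derive (fun x => exp (- t ^ 2 * (1 + x ^ 2) / 2) / (1 + x ^ 2)) x.
Proof. auto_derive. generalize (one_plus_sq_pos x); simpl; lra. Qed.

Lemma is_derive_polar (t : R) : is_derive polar t (- gauss t * gauss_cos 0 t).
Proof.
  unfold polar.
  assert (D : forall x t : R, is_derive
     (fun t => exp (- t ^ 2 * (1 + x ^ 2) / 2) / (1 + x ^ 2)) t
     (- t * exp (- t ^ 2 * (1 + x ^ 2) / 2))).
  { intros x s. generalize (one_plus_sq_pos x); intros P.
    auto_derive; [simpl in *; lra|].
    match goal with |- context [exp ?a] => replace a with (- s ^ 2 * (1 + x ^ 2) / 2) by (field) end.
    field; simpl in *; lra. }
  replace (- gauss t * gauss_cos 0 t) with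
    (RInt (fun x => Derive (fun t => exp (- t ^ 2 * (1 + x ^ 2) / 2) / (1 + x ^ 2)) t) 0 1).
  - apply is_derive_RInt_param.
    + apply filter_forall; intros s x _. eexists; apply D.
    + intros x _.
      apply continuity_2d_pt_ext with (fun s x => - s * exp (- s ^ 2 * (1 + x ^ 2) / 2)).
      { intros s y. symmetry. apply is_derive_unique, D. }
      unfold Rdiv, pow; continuity_2d.
    + apply filter_forall; intros s. apply ex_RInt_of_derivable, ex_derive_polar_integrand.
  - transitivity (RInt (fun x => - gauss t * (t * (gauss (t * x + 0) * cos (0 * (t * x + 0))))) 0 1).
    + apply RInt_ext. intros x _. etransitivity; [apply is_derive_unique, D|].
      rewrite Rmult_0_l, cos_0. unfold gauss.
      replace (- t ^ 2 * (1 + x ^ 2) / 2) with (- t ^ 2 / 2 + - (t * x + 0) ^ 2 / 2)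
        by (as_real; field).
      rewrite exp_plus. as_real; ring.
    + apply is_RInt_unique.
      apply (is_RInt_scal (V := R_NormedModule)).
      apply (is_RInt_comp_lin (V := R_NormedModule) (fun x => gauss x * cos (0 * x))).
      replace (t * 0 + 0) with 0 by (as_real; ring).
      replace (t * 1 + 0) with t by (as_real; ring).
      apply (RInt_correct (V := R_CompleteNormedModule)), ex_RInt_of_derivable.
      apply ex_derive_gauss_cos_integrand.
Qed.

(** The derivatives of the two terms in [T] cancel, by the substitution [z = T x]
    in the derivative of [polar]; at [T = 0] the left side is [2 * atan 1]. *)
Lemma gauss_mass T : gauss_cos 0 T ^ 2 + 2 * polar T = PI / 2.
Proof.
  assert (D : forall t : R, is_derive (fun t => gauss_cos 0 t ^ 2 + 2 * polar t) t 0).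
  { intros t.
    evar_last.
    - apply (is_derive_plus (V := R_NormedModule) (fun t => gauss_cos 0 t ^ 2) (fun t => 2 * polar t)).
      + apply (is_derive_pow (gauss_cos 0) 2), is_derive_gauss_cos.
      + apply is_derive_scal, is_derive_polar.
    - rewrite Rmult_0_l, cos_0. unfold plus, scal; simpl; unfold mult; simpl; ring. }
  transitivity (gauss_cos 0 0 ^ 2 + 2 * polar 0).
  - destruct (MVT_gen (fun t => gauss_cos 0 t ^ 2 + 2 * polar t) 0 T (fun _ => 0)) as [c [_ E]].
    + intros; apply D.
    + intros t _. apply continuity_pt_filterlim.
      apply (ex_derive_continuous (fun t => gauss_cos 0 t ^ 2 + 2 * polar t)). eexists; apply D.
    + lra.
  - unfold gauss_cos. rewrite RInt_point. unfold zero; simpl.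
    replace (polar 0) with (atan 1 - atan 0).
    + rewrite atan_1, atan_0. field.
    + symmetry. apply is_RInt_unique.
      apply is_RInt_ext with (fun x => / (1 + x ^ 2)).
      { intros x _. replace (- 0 ^ 2 * (1 + x ^ 2) / 2) with 0 by field.
        rewrite exp_0. unfold Rdiv; as_real; ring. }
      apply (is_RInt_derive (V := R_CompleteNormedModule) atan).
      * intros x _. apply is_derive_Reals, derivable_pt_lim_atan.
      * intros x _. apply (continuous_of_derivable (fun x => / (1 + x ^ 2))). intros z.
        auto_derive. generalize (one_plus_sq_pos z); simpl; lra.
Qed.

Lemma polar_bounds T : 0 <= polar T <= gauss T.
Proof.
  assert (C := RInt_correct (V := R_CompleteNormedModule) _ _ _
    (ex_RInt_of_derivable _ 0 1 (ex_derive_polar_integrand T))).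
  split.
  - apply RInt_ge_0; [lra | eexists; apply C |].
    intros x _. apply Rlt_le, Rdiv_lt_0_compat; [apply exp_pos | apply one_plus_sq_pos].
  - replace (gauss T) with (RInt (fun _ => gauss T) 0 1).
    2:{ rewrite RInt_const. unfold scal; simpl; unfold mult; simpl; ring. }
    apply RInt_le; [lra | eexists; apply C | apply ex_RInt_const |].
    intros x _. generalize (one_plus_sq_pos x); intros P.
    apply Rle_trans with (exp (- T ^ 2 * (1 + x ^ 2) / 2) / 1).
    + apply Rmult_le_compat_l; [apply Rlt_le, exp_pos|].
      apply Rinv_le_contravar; nra.
    + unfold Rdiv at 1; rewrite Rinv_1, Rmult_1_r. unfold gauss.
      destruct (Rle_lt_or_eq_dec (- T ^ 2 * (1 + x ^ 2) / 2) (- T ^ 2 / 2)) as [L|E].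
      * generalize (Rmult_le_pos _ _ (pow2_ge_0 T) (pow2_ge_0 x)); lra.
      * now apply Rlt_le, exp_increasing.
      * rewrite E; lra.
Qed.

Lemma gauss_lim : is_lim gauss p_infty 0.
Proof.
  apply (is_lim_comp exp (fun x => - x ^ 2 / 2) p_infty 0 m_infty).
  - exact is_lim_exp_m.
  - apply is_lim_ext with (fun x => - (x * x * / 2)).
    { intros x; field. }
    replace m_infty with (Rbar_opp (Rbar_mult (Rbar_mult p_infty p_infty) (/2))).
    2:{ simpl. destruct (Rle_dec 0 (/2)) as [h|h]; [|lra].
       destruct (Rle_lt_or_eq_dec 0 (/2) h); [reflexivity|lra]. }
    apply is_lim_opp. apply is_lim_mult. 
    + apply is_lim_mult; try apply is_lim_id. exact I.
    + apply is_lim_const.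
    + simpl; lra.
  - exists 0; intros; discriminate.
Qed.

Lemma gauss_cos_0_lim : is_lim (gauss_cos 0) p_infty (sqrt (PI / 2)).
Proof.
  assert (P := PI_RGT_0).
  apply is_lim_ext_loc with (fun T => sqrt (PI / 2 - 2 * polar T)).
  - exists 0; intros T HT.
    rewrite <- (gauss_mass T).
    replace (gauss_cos 0 T ^ 2 + 2 * polar T - 2 * polar T) with (gauss_cos 0 T ^ 2) by ring.
    apply sqrt_pow2. apply RInt_ge_0; [lra | |].
    + apply ex_RInt_of_derivable, ex_derive_gauss_cos_integrand.
    + intros x _. rewrite Rmult_0_l, cos_0, Rmult_1_r. apply Rlt_le, gauss_pos.
  - apply (is_lim_comp_continuous (fun T => PI / 2 - 2 * polar T) sqrt p_infty (PI / 2));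
      [| apply continuity_pt_filterlim, continuity_pt_sqrt; lra].
    replace (Finite (PI / 2)) with (Finite (PI / 2 - 2 * 0)) by (f_equal; ring).
    apply is_lim_minus'; [apply is_lim_const |].
    apply (is_lim_scal_l polar 2 p_infty 0).
    apply is_lim_le_le_loc with (fun _ => 0) gauss.
    + exists 0; intros; apply polar_bounds.
    + apply is_lim_const.
    + apply gauss_lim.
Qed.

(** * Uniform bounds *)

(** A weight bounded by 1 reduces the bounds and Cauchy estimates for the cosine and sine
    integrals, at every frequency and for every order of the end points, to those
    for the plain Gaussian integral. *)
Lemma gauss_weighted_increment (w : R -> R) p q :
  (forall x, ex_derive (fun x => gauss x * w x) x) -> (forall x, Rabs (w x) <= 1) ->
  Rabs (RInt (fun x => gauss x * w x) 0 q - RInt (fun x => gauss x * w x) 0 p)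
  <= Rabs (gauss_cos 0 q - gauss_cos 0 p).
Proof.
  intros D B.
  assert (E : forall p q, p <= q ->
    Rabs (RInt (fun x => gauss x * w x) 0 q - RInt (fun x => gauss x * w x) 0 p)
    <= gauss_cos 0 q - gauss_cos 0 p).
  { clear p q; intros p q L.
    assert (Ch : forall h : R -> R, (forall x, ex_derive h x) ->
       is_RInt h p q (RInt h 0 q - RInt h 0 p)).
    { intros h Dh.
      apply (is_RInt_derive (V := R_CompleteNormedModule) (fun T => RInt h 0 T)).
      - intros; now apply is_derive_primitive.
      - intros; now apply continuous_of_derivable. }
    apply (norm_RInt_le (V := R_NormedModule) (fun x => gauss x * w x) (fun x => gauss x * cos (0 * x)) p q).
    - exact L.
    - intros x _. unfold norm; simpl; unfold abs; simpl.
      rewrite Rabs_mult, Rabs_pos_eq by apply Rlt_le, gauss_pos.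
      apply Rmult_le_compat_l; [apply Rlt_le, gauss_pos|].
      now rewrite Rmult_0_l, cos_0.
    - now apply Ch.
    - apply Ch, ex_derive_gauss_cos_integrand. }
  destruct (Rle_or_lt p q) as [L|L].
  - eapply Rle_trans; [apply E, L | apply Rle_abs].
  - rewrite Rabs_minus_sym, (Rabs_minus_sym (gauss_cos 0 q)).
    eapply Rle_trans; [apply E; lra | apply Rle_abs].
Qed.

Lemma gauss_cos_increment c p q :
  Rabs (gauss_cos c q - gauss_cos c p) <= Rabs (gauss_cos 0 q - gauss_cos 0 p).
Proof.
  apply gauss_weighted_increment.
  - apply ex_derive_gauss_cos_integrand.
  - intros x; apply Rabs_le, COS_bound.
Qed.

Lemma gauss_sin_increment c p q :
  Rabs (gauss_sin c q - gauss_sin c p) <= Rabs (gauss_cos 0 q - gauss_cos 0 p).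
Proof.
  apply gauss_weighted_increment.
  - apply ex_derive_gauss_sin_integrand.
  - intros x; apply Rabs_le, SIN_bound.
Qed.

Lemma gauss_cos_at_0 c : gauss_cos c 0 = 0.
Proof. apply (RInt_point (V := R_CompleteNormedModule)). Qed.

Lemma gauss_sin_at_0 c : gauss_sin c 0 = 0.
Proof. apply (RInt_point (V := R_CompleteNormedModule)). Qed.

Lemma gauss_cos_0_bound T : Rabs (gauss_cos 0 T) <= sqrt (PI / 2).
Proof.
  rewrite <- sqrt_Rsqr_abs. apply sqrt_le_1_alt.
  rewrite <- (gauss_mass T). unfold Rsqr. generalize (polar_bounds T); nra.
Qed.

Lemma gauss_cos_bound c T : Rabs (gauss_cos c T) <= sqrt (PI / 2).
Proof.
  generalize (gauss_cos_increment c 0 T) (gauss_cos_0_bound T).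
  rewrite !gauss_cos_at_0, !Rminus_0_r. lra.
Qed.

Lemma gauss_sin_bound c T : Rabs (gauss_sin c T) <= sqrt (PI / 2).
Proof.
  generalize (gauss_sin_increment c 0 T) (gauss_cos_0_bound T).
  rewrite gauss_cos_at_0, gauss_sin_at_0, !Rminus_0_r. lra.
Qed.

(** * Dependence on the frequency *)

(** Differentiation under the integral gives [- x * gauss x * sin (c * x)], and
    [- x * gauss x] is the derivative of [gauss], so one integration by parts
    brings back [gauss_cos]. *)
Lemma is_derive_gauss_cos_freq (T c : R) :
  is_derive (fun c => gauss_cos c T) c (gauss T * sin (c * T) - c * gauss_cos c T).
Proof.
  unfold gauss_cos at 1.
  assert (D : forall x c : R, is_derive (fun c => gauss x * cos (c * x)) c
     (- x * gauss x * sin (c * x))).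
  { intros x s. auto_derive; auto; ring. }
  replace (gauss T * sin (c * T) - c * gauss_cos c T) with
    (RInt (fun x => Derive (fun c => gauss x * cos (c * x)) c) 0 T).
  - apply is_derive_RInt_param.
    + apply filter_forall; intros s x _. eexists; apply D.
    + intros x _.
      apply continuity_2d_pt_ext with (fun s x => - x * gauss x * sin (s * x)).
      { intros s y. symmetry. apply is_derive_unique, D. }
      unfold gauss, Rdiv, pow; continuity_2d.
    + apply filter_forall; intros s. apply ex_RInt_of_derivable, ex_derive_gauss_cos_integrand.
  - apply is_RInt_unique.
    apply is_RInt_ext with (fun x => - x * gauss x * sin (c * x)).
    { intros x _. symmetry. apply is_derive_unique, D. }
    replace (gauss T * sin (c * T) - c * gauss_cos c T) with
      ((gauss T * sin (c * T) - c * gauss_cos c T) -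
       (gauss 0 * sin (c * 0) - c * gauss_cos c 0)).
    2:{ rewrite Rmult_0_r, sin_0, gauss_cos_at_0; ring. }
    apply (is_RInt_derive (V := R_CompleteNormedModule)
      (fun x => gauss x * sin (c * x) - c * gauss_cos c x)
      (fun x => - x * gauss x * sin (c * x))).
    + intros x _.
      replace (- x * gauss x * sin (c * x)) with
        ((- x * gauss x * sin (c * x) + gauss x * (c * cos (c * x)))
          - c * (gauss x * cos (c * x))) by ring.
      apply (is_derive_minus (V := R_NormedModule)).
      * unfold gauss. auto_derive; auto. unfold pow, Rdiv. field.
      * apply (is_derive_scal (gauss_cos c)), is_derive_gauss_cos.
    + intros x _. apply (continuous_of_derivable (fun x => - x * gauss x * sin (c * x))).
      intros z; unfold gauss; auto_derive; auto.
Qed.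

(** The integrating factor [exp (c^2 / 2)] leaves only the boundary term, of size
    [gauss T]; it vanishes as [T] grows, so that [gauss_cos c T] tends to
    [gauss c] times the limit of [gauss_cos 0 T]. *)
Lemma gauss_cos_freq_error c T :
  Rabs (exp (c ^ 2 / 2) * gauss_cos c T - gauss_cos 0 T)
    <= Rabs c * exp (c ^ 2 / 2) * gauss T.
Proof.
  set (H := fun c => exp (c ^ 2 / 2) * gauss_cos c T).
  assert (D : forall c : R, is_derive H c (exp (c ^ 2 / 2) * (gauss T * sin (c * T)))).
  { intros s. unfold H.
    evar_last.
    - apply (is_derive_mult (fun c : R => exp (c ^ 2 / 2)) (fun c => gauss_cos c T)).
      + apply (is_derive_comp (V := R_NormedModule) exp (fun c => c ^ 2 / 2)).
        * apply is_derive_exp.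
        * assert (E : is_derive (fun c => c ^ 2 / 2) s s) by (auto_derive; auto; field).
          exact E.
      + apply is_derive_gauss_cos_freq.
      + intros; apply Rmult_comm.
    - unfold plus, mult, scal; simpl; unfold mult; simpl; ring. }
  destruct (MVT_gen H 0 c (fun c => exp (c ^ 2 / 2) * (gauss T * sin (c * T)))) as [s [Bs E]].
  - intros; apply D.
  - intros x _. apply continuity_pt_filterlim, (ex_derive_continuous H). eexists; apply D.
  - replace (gauss_cos 0 T) with (H 0).
    2:{ unfold H. replace (0 ^ 2 / 2) with 0 by field. rewrite exp_0; ring. }
    change (Rabs (H c - H 0) <= Rabs c * exp (c ^ 2 / 2) * gauss T).
    rewrite E, !Rabs_mult, Rminus_0_r.
    rewrite (Rabs_pos_eq (exp _)) by apply Rlt_le, exp_pos.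
    rewrite (Rabs_pos_eq (gauss _)) by apply Rlt_le, gauss_pos.
    assert (E1 : exp (s ^ 2 / 2) <= exp (c ^ 2 / 2)).
    { assert (L : s ^ 2 / 2 <= c ^ 2 / 2).
      { unfold Rmin, Rmax in Bs; destruct (Rle_dec 0 c); nra. }
      destruct L as [L|L]; [now apply Rlt_le, exp_increasing | rewrite L; lra]. }
    assert (E2 : Rabs (sin (s * T)) <= 1) by apply Rabs_le, SIN_bound.
    assert (P := exp_pos (s ^ 2 / 2)). assert (G := gauss_pos T).
    assert (A := Rabs_pos c). assert (A' := Rabs_pos (sin (s * T))).
    apply Rle_trans with (exp (c ^ 2 / 2) * (gauss T * 1) * Rabs c); [|lra].
    apply Rmult_le_compat_r; auto.
    apply Rmult_le_compat; auto; try lra; try nra.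
Qed.

Lemma gauss_cos_lim c :
  is_lim (gauss_cos c) p_infty (sqrt (PI / 2) * gauss c).
Proof.
  assert (Eg : gauss c * exp (c ^ 2 / 2) = 1).
  { unfold gauss. rewrite <- exp_plus, <- exp_0. f_equal; field. }
  apply is_lim_ext with
    (fun T => (gauss_cos 0 T + (exp (c ^ 2 / 2) * gauss_cos c T - gauss_cos 0 T)) * gauss c).
  { intros T. transitivity (gauss_cos c T * (gauss c * exp (c ^ 2 / 2))); [ring|].
    rewrite Eg; ring. }
  apply (is_lim_scal_r _ (gauss c) p_infty (sqrt (PI / 2))).
  replace (Finite (sqrt (PI / 2))) with (Finite (sqrt (PI / 2) + 0)) by (f_equal; ring).
  apply is_lim_plus'; [apply gauss_cos_0_lim|].
  set (K := Rabs c * exp (c ^ 2 / 2)).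
  assert (L : is_lim (fun T => K * gauss T) p_infty 0).
  { replace (Finite 0) with (Rbar_mult K 0) by (simpl; f_equal; ring).
    apply is_lim_scal_l, gauss_lim. }
  apply is_lim_le_le_loc with (fun T => - (K * gauss T)) (fun T => K * gauss T).
  - exists 0; intros T _. generalize (gauss_cos_freq_error c T). fold K.
    intros E. split; [|eapply Rle_trans; [apply Rle_abs | exact E]].
    apply Ropp_le_cancel. rewrite Ropp_involutive.
    eapply Rle_trans; [apply Rle_abs|]. now rewrite Rabs_Ropp.
  - replace (Finite 0) with (Rbar_opp 0) by (simpl; f_equal; ring).
    now apply is_lim_opp.
  - exact L.
Qed.

(** * Square partial sums of double series *)

Definition square_sum {G : AbelianMonoid} (q : nat -> nat -> G) (N : nat) : G :=
  sum_n (fun r => sum_n (q r) N) N.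

(** The terms added when the square grows from side [N] to side [N + 1]. *)
Definition shell {G : AbelianMonoid} (q : nat -> nat -> G) (N : nat) : G :=
  plus (sum_n (fun r => q r (S N)) N) (sum_n (q (S N)) (S N)).

Lemma square_sum_Sn {G : AbelianMonoid} (q : nat -> nat -> G) N :
  square_sum q (S N) = plus (square_sum q N) (shell q N).
Proof.
  unfold square_sum, shell. rewrite sum_Sn.
  rewrite (sum_n_ext _ (fun r => plus (sum_n (q r) N) (q r (S N)))).
  2:{ intros r; apply sum_Sn. }
  rewrite sum_n_plus. symmetry; apply plus_assoc.
Qed.

Lemma norm_sum_n_le {K : AbsRing} {V : NormedModule K} (q : nat -> V) (p : nat -> R) N :
  (forall n, norm (q n) <= p n) -> norm (sum_n q N) <= sum_n p N.
Proof.
  intros H. eapply Rle_trans; [apply norm_sum_n_m|].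
  apply (sum_n_m_le (fun n => norm (q n)) p). exact H.
Qed.

(** Increments of square sums are finite sums of terms, so domination passes from
    the terms to the increments; this yields the Cauchy property without
    reordering a double series. *)
Lemma norm_square_sum_increment {K : AbsRing} {V : NormedModule K}
    (q : nat -> nat -> V) (p : nat -> nat -> R) N k :
  (forall r s, norm (q r s) <= p r s) ->
  norm (minus (square_sum q (k + N)) (square_sum q N))
    <= square_sum p (k + N) - square_sum p N.
Proof.
  intros H. induction k as [|k IH].
  - simpl. rewrite minus_eq_zero, Rminus_diag. right; apply (norm_zero (V := V)).
  - simpl. rewrite !square_sum_Sn.
    replace (minus (plus (square_sum q (k + N)) (shell q (k + N))) (square_sum q N))
      with (plus (minus (square_sum q (k + N)) (square_sum q N)) (shell q (k + N))).
    2:{ unfold minus. rewrite <- !plus_assoc. f_equal. apply plus_comm. }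
    eapply Rle_trans; [apply norm_triangle|].
    assert (Sh : norm (shell q (k + N)) <= shell p (k + N)).
    { unfold shell. eapply Rle_trans; [apply norm_triangle|].
      apply Rplus_le_compat; apply norm_sum_n_le; intros; apply H. }
    change (@plus _ (square_sum p (k + N)) (shell p (k + N)))
      with (square_sum p (k + N) + shell p (k + N)).
    lra.
Qed.

Lemma square_sum_mult {K : Ring} (k : K) (a b : nat -> K) N :
  square_sum (fun r s => mult k (mult (a r) (b s))) N = mult k (mult (sum_n a N) (sum_n b N)).
Proof.
  unfold square_sum. rewrite <- sum_n_mult_r, <- sum_n_mult_l. apply sum_n_ext; intros r.
  now rewrite !sum_n_mult_l.
Qed.

Lemma square_sum_mult_lim (a b : nat -> C) (A B k : C) :
  is_series (V := C_R_NormedModule) a A -> is_series (V := C_R_NormedModule) b B ->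
  filterlim (fun N => square_sum (G := C_R_NormedModule) (fun r s => k * (a r * b s))%C N)
    eventually (locally (T := C_R_NormedModule) (k * (A * B))%C).
Proof.
  intros HA HB.
  apply filterlim_ext with (fun N => (k * (sum_n (G := C_R_NormedModule) a N * sum_n (G := C_R_NormedModule) b N))%C).
  { intros N.
    symmetry. exact (square_sum_mult (K := C_Ring) k a b N). }
  assert (M : forall (f g : nat -> C) (F G : C),
    filterlim f eventually (locally (T := C_UniformSpace) F) ->
    filterlim g eventually (locally (T := C_UniformSpace) G) ->
    filterlim (fun N => (f N * g N)%C) eventually (locally (T := C_UniformSpace) (F * G)%C)).
  { intros f g F G Hf Hg.
    (* The product limit holds for the topology of the absolute value on C, the
       series converge for the product topology; both have the same neighbourhoods. *)
    assert (toC : forall (h : nat -> C) l,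
      filterlim h eventually (locally (T := C_UniformSpace) l) <->
      filterlim h eventually (locally (T := AbsRing_UniformSpace C_AbsRing) l)).
    { intros h l; split; intros Hl P HP; apply Hl; now apply locally_C. }
    apply toC.
    apply (filterlim_comp_2 (G := locally (T := AbsRing_UniformSpace C_AbsRing) F)
       (H := locally (T := AbsRing_UniformSpace C_AbsRing) G)
       f g (fun x y : C => (x * y)%C)).
    - now apply toC.
    - now apply toC.
    - exact (filterlim_mult (K := C_AbsRing) F G). }
  apply M; [apply filterlim_const|].
  now apply M.
Qed.

(** Weierstrass test for [w r * w s * h r s]: the dominating square sums are
    [K] times the squares of the partial sums of [Cmod (w r)], hence Cauchy.
    It is applied both to integrands and to primitives. *)
Lemma square_sum_uniform (w : nat -> C) (h : nat -> nat -> R -> R) (K : R) :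
  ex_series (fun r => Cmod (w r)) ->
  (forall r s x, Rabs (h r s x) <= K) ->
  exists g : R -> C,
    filterlim (fun N x => square_sum (G := C_R_NormedModule)
                            (fun r s => w r * w s * RtoC (h r s x))%C N)
      eventually (locally (T := fct_UniformSpace R C_R_CompleteNormedModule) g).
Proof.
  intros [W HW] Hh.
  set (p := fun r s => K * (Cmod (w r) * Cmod (w s))).
  set (D := fun (N : nat) (x : R) => square_sum (G := C_R_NormedModule)
                            (fun r s => w r * w s * RtoC (h r s x))%C N).
  assert (B : forall N k x, norm (V := C_R_NormedModule) (minus (D (k + N)%nat x) (D N x))
     <= square_sum p (k + N) - square_sum p N).
  { intros N k x. apply norm_square_sum_increment. intros r s.
    rewrite <- Cmod_norm, !Cmod_mult, Cmod_R. unfold p.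
    rewrite Rmult_comm. apply Rmult_le_compat_r; [|apply Hh].
    apply Rmult_le_pos; apply Cmod_ge_0. }
  assert (Lp : filterlim (square_sum p) eventually (locally (K * (W * W)))).
  { apply filterlim_ext with (fun N => K * (sum_n (fun r => Cmod (w r)) N * sum_n (fun r => Cmod (w r)) N)).
    - intros N. symmetry.
      exact (square_sum_mult (K := R_Ring) K (fun r => Cmod (w r)) (fun r => Cmod (w r)) N).
    - apply (is_lim_seq_scal_l _ K (W * W)). 
      apply (is_lim_seq_mult' _ _ W W); exact HW. }
  assert (Cp := proj2 (filterlim_locally_cauchy (U := R_CompleteSpace) (F := eventually)
    (square_sum p)) (ex_intro _ (K * (W * W)) Lp)).
  apply (filterlim_locally_cauchy (U := fct_CompleteSpace) (D : nat -> R -> C_R_CompleteNormedModule)).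
  intros eps. destruct (Cp eps) as [P [HP HC]].
  exists P; split; [exact HP|].
  assert (O : forall N M, P N -> P M -> (N <= M)%nat -> forall x,
    ball (M := C_R_NormedModule) (D N x) eps (D M x)).
  { intros N M PN PM L x. apply (norm_compat1 (V := C_R_NormedModule)).
    replace M with (M - N + N)%nat by lia.
    eapply Rle_lt_trans; [apply B|].
    replace (M - N + N)%nat with M by lia.
    eapply Rle_lt_trans; [apply Rle_abs | apply (HC N M PN PM)]. }
  intros N M PN PM x. destruct (Nat.le_ge_cases N M) as [L|L].
  - now apply O.
  - now apply ball_sym, O.
Qed.

Lemma is_RInt_RtoC (w : C) (f : R -> R) a b l :
  is_RInt f a b l ->
  is_RInt (V := C_R_NormedModule) (fun x => w * RtoC (f x))%C a b (w * RtoC l)%C.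
Proof.
  intros H.
  apply is_RInt_ext with (fun x => (f x * fst w, f x * snd w)).
  { intros x _. unfold Cmult, RtoC; simpl. f_equal; ring. }
  replace (w * RtoC l)%C with (l * fst w, l * snd w).
  2:{ unfold Cmult, RtoC; simpl. f_equal; ring. }
  assert (S : forall k, is_RInt (fun x => f x * k) a b (l * k)).
  { intros k. apply is_RInt_ext with (fun x => k * f x); [intros; apply Rmult_comm|].
    rewrite Rmult_comm. now apply (is_RInt_scal (V := R_NormedModule)). }
  apply (is_RInt_fct_extend_pair (U := R_NormedModule) (V := R_NormedModule)); apply S.
Qed.

Lemma is_RInt_sum_n {V : NormedModule R_AbsRing} (f : nat -> R -> V) a b (l : nat -> V) N :
  (forall n, is_RInt (f n) a b (l n)) ->
  is_RInt (fun x => sum_n (fun n => f n x) N) a b (sum_n l N).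
Proof.
  intros H. induction N as [|N IH].
  - rewrite sum_O. apply is_RInt_ext with (f 0%nat); [intros; now rewrite sum_O | apply H].
  - rewrite sum_Sn. apply is_RInt_ext with (fun x => plus (sum_n (fun n => f n x) N) (f (S N) x)).
    + intros; now rewrite sum_Sn.
    + now apply is_RInt_plus.
Qed.

Lemma filterlim_sum_n {T} {K : AbsRing} {V : NormedModule K} (F : (T -> Prop) -> Prop)
    {FF : Filter F} (f : nat -> T -> V) (l : nat -> V) N :
  (forall n, filterlim (f n) F (locally (l n))) ->
  filterlim (fun t => sum_n (fun n => f n t) N) F (locally (sum_n l N)).
Proof.
  intros H. induction N as [|N IH].
  - rewrite sum_O. apply filterlim_ext with (f 0%nat); [intros; now rewrite sum_O | apply H].
  - rewrite sum_Sn. apply filterlim_ext with (fun x => plus (sum_n (fun n => f n x) N) (f (S N) x)).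
    + intros; now rewrite sum_Sn.
    + apply (filterlim_comp_2 _ _ plus IH (H (S N))), filterlim_plus.
Qed.

Lemma filterlim_RtoC {T} (F : (T -> Prop) -> Prop) {FF : Filter F} (w : C) (f : T -> R) (l : R) :
  filterlim f F (locally l) ->
  filterlim (fun t => w * RtoC (f t))%C F (locally (T := C_R_NormedModule) (w * RtoC l)%C).
Proof.
  intros H.
  assert (E : forall a, (w * RtoC a)%C = scal (V := C_R_NormedModule) a w).
  { intros a. unfold Cmult, RtoC, scal; simpl. unfold prod_scal, scal; simpl.
    unfold mult; simpl. f_equal; ring. }
  rewrite E. apply filterlim_ext with (fun t => scal (V := C_R_NormedModule) (f t) w).
  { intros; symmetry; apply E. }
  apply (filterlim_comp_2 (G := locally l) (H := locally (T := C_R_NormedModule) w) f (fun _ => w) (scal (V := C_R_NormedModule)) H (filterlim_const w)).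
  exact (filterlim_scal (V := C_R_NormedModule) l w).
Qed.

Lemma ex_series_C_bounded (w : nat -> C) (h : nat -> R) (K : R) :
  ex_series (fun r => Cmod (w r)) -> (forall r, Rabs (h r) <= K) ->
  is_series (V := C_R_NormedModule) (fun r => w r * RtoC (h r))%C
    (CSeries (fun r => w r * RtoC (h r))%C).
Proof.
  intros Hw Hh.
  assert (X : ex_series (V := C_R_CompleteNormedModule) (fun r => w r * RtoC (h r))%C).
  { apply (ex_series_le (V := C_R_CompleteNormedModule) _ (fun r => scal K (Cmod (w r)))).
    - intros r. 
      change (norm (V := C_R_NormedModule) (w r * RtoC (h r))%C <= scal K (Cmod (w r))).
      rewrite <- Cmod_norm, Cmod_mult, Cmod_R, Rmult_comm.
      apply Rmult_le_compat_r; [apply Cmod_ge_0 | apply Hh].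
    - now apply (ex_series_scal (V := R_NormedModule)). }
  destruct X as [l Hl]. now rewrite (CSeries_unique _ _ Hl).
Qed.

(** * Completing the square *)

(** Half of the integral of [gauss t * cos (c * t)] between [- T - a] and [T - a],
    written with the oddness of [gauss_cos] in its bound; [shift_sin] is the
    same for [sin], where evenness makes it a difference. *)
Definition shift_cos (a c T : R) : R := (gauss_cos c (T - a) + gauss_cos c (T + a)) / 2.
Definition shift_sin (a c T : R) : R := (gauss_sin c (T - a) - gauss_sin c (T + a)) / 2.

Lemma is_derive_shift_cos (a c T : R) :
  is_derive (shift_cos a c) T
    ((gauss (T - a) * cos (c * (T - a)) + gauss (T + a) * cos (c * (T + a))) / 2).
Proof.
  assert (D : forall x : R, ex_derive (gauss_cos c) x) by (intros; eexists; apply is_derive_gauss_cos).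
  unfold shift_cos. auto_derive.
  - repeat split; apply D.
  - rewrite !(is_derive_unique _ _ _ (is_derive_gauss_cos _ _)). unfold Rminus; field.
Qed.

Lemma is_derive_shift_sin (a c T : R) :
  is_derive (shift_sin a c) T
    ((gauss (T - a) * sin (c * (T - a)) - gauss (T + a) * sin (c * (T + a))) / 2).
Proof.
  assert (D : forall x : R, ex_derive (gauss_sin c) x) by (intros; eexists; apply is_derive_gauss_sin).
  unfold shift_sin. auto_derive.
  - repeat split; apply D.
  - rewrite !(is_derive_unique _ _ _ (is_derive_gauss_sin _ _)). unfold Rminus; field.
Qed.

Lemma shift_cos_at_0 a c : shift_cos a c 0 = 0.
Proof.
  unfold shift_cos. replace (0 - a) with (- (0 + a)) by ring.
  rewrite gauss_cos_odd; field.
Qed.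

Lemma shift_sin_at_0 a c : shift_sin a c 0 = 0.
Proof.
  unfold shift_sin. replace (0 - a) with (- (0 + a)) by ring.
  rewrite gauss_sin_even; field.
Qed.

Lemma shift_cos_bound a c T : Rabs (shift_cos a c T) <= sqrt (PI / 2).
Proof.
  generalize (gauss_cos_bound c (T - a)) (gauss_cos_bound c (T + a)).
  unfold shift_cos; intros H1 H2.
  apply Rabs_le. apply Rabs_le_between in H1. apply Rabs_le_between in H2. lra.
Qed.

Lemma shift_sin_bound a c T : Rabs (shift_sin a c T) <= sqrt (PI / 2).
Proof.
  generalize (gauss_sin_bound c (T - a)) (gauss_sin_bound c (T + a)).
  unfold shift_sin; intros H1 H2.
  apply Rabs_le. apply Rabs_le_between in H1. apply Rabs_le_between in H2. lra.
Qed.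

Lemma is_lim_translate (f : R -> R) (a l : R) :
  is_lim f p_infty l -> is_lim (fun T => f (T + a)) p_infty l.
Proof.
  intros H. apply is_lim_comp with p_infty; [exact H | |].
  - replace p_infty with (Rbar_plus p_infty a) by reflexivity.
    apply (is_lim_plus (fun T => T) (fun _ => a) p_infty p_infty a);
      [apply is_lim_id | apply is_lim_const | reflexivity].
  - exists 0; intros; discriminate.
Qed.

Lemma shift_cos_lim a c : is_lim (shift_cos a c) p_infty (sqrt (PI / 2) * gauss c).
Proof.
  assert (L := gauss_cos_lim c).
  replace (Finite (sqrt (PI / 2) * gauss c)) with
    (Rbar_mult (sqrt (PI / 2) * gauss c + sqrt (PI / 2) * gauss c) (/ 2))
    by (simpl; f_equal; field).
  apply is_lim_scal_r.
  apply is_lim_plus'; [apply (is_lim_translate _ (- a)) | apply (is_lim_translate _ a)]; exact L.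
Qed.

(** The interval between [T - a] and [T + a] has bounded length and carries a
    Gaussian mass tending to 0. *)
Lemma shift_sin_lim a c : is_lim (shift_sin a c) p_infty 0.
Proof.
  assert (L : is_lim (fun T => Rabs (gauss_cos 0 (T - a) - gauss_cos 0 (T + a)) / 2) p_infty 0).
  { replace (Finite 0) with (Rbar_mult (Rabs (sqrt (PI / 2) - sqrt (PI / 2))) (/ 2)).
    2:{ simpl. rewrite Rminus_diag, Rabs_R0. f_equal; ring. }
    apply is_lim_scal_r.
    apply (is_lim_comp_continuous (fun T => gauss_cos 0 (T - a) - gauss_cos 0 (T + a)) Rabs
      p_infty (sqrt (PI / 2) - sqrt (PI / 2))); [|apply continuous_Rabs].
    apply is_lim_minus'; [apply (is_lim_translate _ (- a)) | apply (is_lim_translate _ a)];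
      apply gauss_cos_0_lim. }
  apply is_lim_le_le_loc with
    (fun T => - (Rabs (gauss_cos 0 (T - a) - gauss_cos 0 (T + a)) / 2))
    (fun T => Rabs (gauss_cos 0 (T - a) - gauss_cos 0 (T + a)) / 2).
  - exists 0; intros T _. generalize (gauss_sin_increment c (T + a) (T - a)).
    unfold shift_sin; intros H. apply Rabs_le_between in H. lra.
  - replace (Finite 0) with (Rbar_opp 0) by (simpl; f_equal; ring).
    now apply is_lim_opp.
  - exact L.
Qed.

(** Completing the square. *)
Lemma gauss_shift a x : gauss x * (gauss a * exp (a * x)) = gauss (x - a).
Proof. unfold gauss. rewrite <- !exp_plus. f_equal; field. Qed.

Lemma gauss_cosh a x : gauss x * (gauss a * cosh (a * x)) = (gauss (x - a) + gauss (x + a)) / 2.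
Proof.
  replace (x + a) with (x - - a) by ring.
  rewrite <- !gauss_shift, gauss_even. unfold cosh.
  replace (- a * x) with (- (a * x)) by ring. field.
Qed.

Lemma gauss_sinh a x : gauss x * (gauss a * sinh (a * x)) = (gauss (x - a) - gauss (x + a)) / 2.
Proof.
  replace (x + a) with (x - - a) by ring.
  rewrite <- !gauss_shift, gauss_even. unfold sinh.
  replace (- a * x) with (- (a * x)) by ring. field.
Qed.

(** The real form of completing the square under the integral: for
    [t = x - a], [cos (c x)] expands into [cos (c t)] and [sin (c t)] with
    coefficients [cos (c a)] and [- sin (c a)]. *)
Definition cosh_cos_primitive (a c T : R) : R :=
  cos (c * a) * shift_cos a c T - sin (c * a) * shift_sin a c T.

Definition sinh_sin_primitive (a c T : R) : R :=
  sin (c * a) * shift_cos a c T + cos (c * a) * shift_sin a c T.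

Lemma is_RInt_cosh_cos a c T :
  is_RInt (fun x => gauss x * (gauss a * cosh (a * x)) * cos (c * x)) 0 T
    (cosh_cos_primitive a c T).
Proof.
  replace (cosh_cos_primitive a c T) with (cosh_cos_primitive a c T - cosh_cos_primitive a c 0).
  2:{ unfold cosh_cos_primitive. rewrite shift_cos_at_0, shift_sin_at_0; ring. }
  apply (is_RInt_derive (V := R_CompleteNormedModule) (cosh_cos_primitive a c)).
  - intros x _. unfold cosh_cos_primitive.
    evar_last.
    + apply (is_derive_minus (V := R_NormedModule)); apply is_derive_scal;
        [apply is_derive_shift_cos | apply is_derive_shift_sin].
    + rewrite gauss_cosh. unfold minus, plus, opp; simpl.
      replace (c * (x - a)) with (c * x - c * a) by ring.
      replace (c * (x + a)) with (c * x + c * a) by ring.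
      rewrite cos_minus, cos_plus, sin_minus, sin_plus.
      generalize (sin2_cos2 (c * a)); unfold Rsqr; intros E.
      replace ((gauss (x - a) + gauss (x + a)) / 2 * cos (c * x)) with
        ((gauss (x - a) + gauss (x + a)) / 2 * cos (c * x) *
         (sin (c * a) * sin (c * a) + cos (c * a) * cos (c * a))) by (rewrite E; ring).
      field.
  - intros x _.
    apply (continuous_of_derivable (fun x => gauss x * (gauss a * cosh (a * x)) * cos (c * x))).
    intros z; unfold gauss, cosh; auto_derive; auto.
Qed.

Lemma is_RInt_sinh_sin a c T :
  is_RInt (fun x => gauss x * (gauss a * sinh (a * x)) * sin (c * x)) 0 T
    (sinh_sin_primitive a c T).
Proof.
  replace (sinh_sin_primitive a c T) with (sinh_sin_primitive a c T - sinh_sin_primitive a c 0).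
  2:{ unfold sinh_sin_primitive. rewrite shift_cos_at_0, shift_sin_at_0; ring. }
  apply (is_RInt_derive (V := R_CompleteNormedModule) (sinh_sin_primitive a c)).
  - intros x _. unfold sinh_sin_primitive.
    evar_last.
    + apply (is_derive_plus (V := R_NormedModule)); apply is_derive_scal;
        [apply is_derive_shift_cos | apply is_derive_shift_sin].
    + rewrite gauss_sinh. unfold minus, plus, opp; simpl.
      replace (c * (x - a)) with (c * x - c * a) by ring.
      replace (c * (x + a)) with (c * x + c * a) by ring.
      rewrite cos_minus, cos_plus, sin_minus, sin_plus.
      generalize (sin2_cos2 (c * a)); unfold Rsqr; intros E.
      replace ((gauss (x - a) - gauss (x + a)) / 2 * sin (c * x)) with
        ((gauss (x - a) - gauss (x + a)) / 2 * sin (c * x) *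
         (sin (c * a) * sin (c * a) + cos (c * a) * cos (c * a))) by (rewrite E; ring).
      field.
  - intros x _.
    apply (continuous_of_derivable (fun x => gauss x * (gauss a * sinh (a * x)) * sin (c * x))).
    intros z; unfold gauss, sinh; auto_derive; auto.
Qed.

Lemma trig_combination_bound (t A B M : R) :
  Rabs A <= M -> Rabs B <= M ->
  Rabs (cos t * A - sin t * B) <= 2 * M /\ Rabs (sin t * A + cos t * B) <= 2 * M.
Proof.
  intros HA HB.
  assert (Hp : forall w X, -1 <= w <= 1 -> Rabs X <= M -> Rabs (w * X) <= M).
  { intros w X Hw HX. rewrite Rabs_mult. apply Rabs_le in Hw.
    generalize (Rabs_pos w) (Rabs_pos X); nra. }
  assert (C := COS_bound t). assert (S := SIN_bound t).
  split; (eapply Rle_trans; [apply Rabs_triang|]); rewrite ?Rabs_Ropp.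
  - generalize (Hp _ _ C HA) (Hp _ _ S HB); lra.
  - generalize (Hp _ _ S HA) (Hp _ _ C HB); lra.
Qed.

Lemma cosh_cos_primitive_bound a c T : Rabs (cosh_cos_primitive a c T) <= 2 * sqrt (PI / 2).
Proof. apply trig_combination_bound; [apply shift_cos_bound | apply shift_sin_bound]. Qed.

Lemma sinh_sin_primitive_bound a c T : Rabs (sinh_sin_primitive a c T) <= 2 * sqrt (PI / 2).
Proof. apply trig_combination_bound; [apply shift_cos_bound | apply shift_sin_bound]. Qed.

Lemma cosh_cos_primitive_lim a c :
  is_lim (cosh_cos_primitive a c) p_infty (sqrt (PI / 2) * (gauss c * cos (c * a))).
Proof.
  replace (Finite (sqrt (PI / 2) * (gauss c * cos (c * a)))) with
    (Finite (cos (c * a) * (sqrt (PI / 2) * gauss c) - sin (c * a) * 0)) by (f_equal; ring).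
  apply is_lim_minus'.
  - apply (is_lim_scal_l _ _ _ (Finite _)), shift_cos_lim.
  - apply (is_lim_scal_l _ _ _ (Finite _)), shift_sin_lim.
Qed.

Lemma sinh_sin_primitive_lim a c :
  is_lim (sinh_sin_primitive a c) p_infty (sqrt (PI / 2) * (gauss c * sin (c * a))).
Proof.
  replace (Finite (sqrt (PI / 2) * (gauss c * sin (c * a)))) with
    (Finite (sin (c * a) * (sqrt (PI / 2) * gauss c) + cos (c * a) * 0)) by (f_equal; ring).
  apply is_lim_plus'.
  - apply (is_lim_scal_l _ _ _ (Finite _)), shift_cos_lim.
  - apply (is_lim_scal_l _ _ _ (Finite _)), shift_sin_lim.
Qed.

(** * The transform of one kernel *)

(** Serves the product formula
    [cos (b x) * cos (x y) = (cos ((b + y) x) + cos ((b - y) x)) / 2] and its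
    analogue for [sin (b x) * cos (x y)]. *)
Definition average (P : R -> R -> R) (b y : R) (T : R) : R := (P (b + y) T + P (b - y) T) / 2.

Lemma average_bound P b y T M :
  (forall c, Rabs (P c T) <= M) -> Rabs (average P b y T) <= M.
Proof.
  intros H. generalize (H (b + y)) (H (b - y)). unfold average; intros H1 H2.
  apply Rabs_le. apply Rabs_le_between in H1. apply Rabs_le_between in H2. lra.
Qed.

Lemma average_lim P b y (L : R -> R) :
  (forall c, is_lim (P c) p_infty (L c)) ->
  is_lim (average P b y) p_infty ((L (b + y) + L (b - y)) / 2).
Proof.
  intros H. apply (is_lim_scal_r _ _ _ (Finite _)). apply is_lim_plus'; apply H.
Qed.

Lemma is_RInt_average P b y T (k h : R -> R) :
  (forall z w, h (z + w) + h (z - w) = 2 * (h z * cos w)) ->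
  (forall c, is_RInt (fun x => k x * h (c * x)) 0 T (P c T)) ->
  is_RInt (fun x => k x * h (b * x) * cos (x * y)) 0 T (average P b y T).
Proof.
  intros Hh H. unfold average, Rdiv. rewrite Rmult_comm.
  apply is_RInt_ext with
    (fun x => scal (/ 2) (plus (k x * h ((b + y) * x)) (k x * h ((b - y) * x)))).
  - intros x _. unfold scal, plus; simpl; unfold mult; simpl.
    replace ((b + y) * x) with (b * x + x * y) by ring.
    replace ((b - y) * x) with (b * x - x * y) by ring.
    rewrite <- Rmult_plus_distr_l, Hh. as_real; field.
  - apply (is_RInt_scal (V := R_NormedModule)), (is_RInt_plus (V := R_NormedModule)); apply H.
Qed.

Definition freq (r : nat) : R := sqrt (2 * PI) * INR r.

(** The arithmetic reason for self-reciprocity: products of two frequencies are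
    periods of [cos] and [sin]. *)
Lemma freq_mult r s : freq r * freq s = 2 * INR (r * s) * PI.
Proof.
  assert (P := PI_RGT_0).
  unfold freq. rewrite mult_INR.
  transitivity (sqrt (2 * PI) * sqrt (2 * PI) * (INR r * INR s)); [ring|].
  rewrite sqrt_sqrt by lra. ring.
Qed.

Lemma gauss_freq r : gauss (freq r) = exp (- PI * INR r ^ 2).
Proof.
  unfold gauss. f_equal. generalize (freq_mult r r). rewrite mult_INR. intros E.
  transitivity (- (freq r * freq r) / 2); [field | rewrite E; field].
Qed.

(** The transform of the kernel with indices [r], [s] is the kernel with indices
    exchanged: periodicity removes [freq r * freq s] from both phases, which then
    differ by their sign only, and the two Gaussians recombine into [cosh]. *)
Lemma cosh_cos_kernel_value r s y :
  (gauss (freq s + y) * cos ((freq s + y) * freq r) +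
   gauss (freq s - y) * cos ((freq s - y) * freq r)) / 2
  = gauss y * (gauss (freq s) * cosh (freq s * y)) * cos (freq r * y).
Proof.
  replace ((freq s + y) * freq r) with (freq r * y + freq r * freq s) by ring.
  replace ((freq s - y) * freq r) with (- (freq r * y) + freq r * freq s) by ring.
  rewrite freq_mult, !cos_period, cos_neg, gauss_cosh.
  rewrite <- (gauss_even (y - freq s)).
  replace (- (y - freq s)) with (freq s - y) by ring.
  rewrite (Rplus_comm y). field.
Qed.

(** As for [cosh] and [cos], but [sin] is odd: the two Gaussians recombine into
    a difference, with [freq s - y] weighing the negative phase, whence the sign. *)
Lemma sinh_sin_kernel_value r s y :
  (gauss (freq s + y) * sin ((freq s + y) * freq r) +
   gauss (freq s - y) * sin ((freq s - y) * freq r)) / 2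
  = - (gauss y * (gauss (freq s) * sinh (freq s * y)) * sin (freq r * y)).
Proof.
  replace ((freq s + y) * freq r) with (freq r * y + freq r * freq s) by ring.
  replace ((freq s - y) * freq r) with (- (freq r * y) + freq r * freq s) by ring.
  rewrite freq_mult, !sin_period, sin_neg, gauss_sinh.
  rewrite <- (gauss_even (y - freq s)).
  replace (- (y - freq s)) with (freq s - y) by ring.
  rewrite (Rplus_comm y). field.
Qed.

Lemma gauss_le_1 x : gauss x <= 1.
Proof.
  rewrite <- exp_0. unfold gauss.
  destruct (Rle_lt_or_eq_dec (- x ^ 2 / 2) 0) as [L|E].
  - nra.
  - now apply Rlt_le, exp_increasing.
  - rewrite E; lra.
Qed.

(** After completing the square the factor [gauss a] compensates the growth of
    [cosh (a x)], uniformly in [a]. *)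
Lemma gauss_cosh_bound a x : Rabs (gauss x * (gauss a * cosh (a * x))) <= 1.
Proof.
  rewrite gauss_cosh. generalize (gauss_pos (x - a)) (gauss_pos (x + a))
    (gauss_le_1 (x - a)) (gauss_le_1 (x + a)).
  intros; apply Rabs_le; lra.
Qed.

Lemma gauss_sinh_bound a x : Rabs (gauss x * (gauss a * sinh (a * x))) <= 1.
Proof.
  rewrite gauss_sinh. generalize (gauss_pos (x - a)) (gauss_pos (x + a))
    (gauss_le_1 (x - a)) (gauss_le_1 (x + a)).
  intros; apply Rabs_le; lra.
Qed.

(** * Termwise transformation of the double series *)

Lemma uniform_pointwise {T} (F : (T -> Prop) -> Prop) {FF : Filter F} {U : UniformSpace}
    (f : T -> R -> U) (g : R -> U) :
  filterlim f F (locally (T := fct_UniformSpace R U) g) ->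
  forall x, filterlim (fun t => f t x) F (locally (g x)).
Proof.
  intros H x. apply filterlim_locally; intros eps.
  assert (H' := proj1 (filterlim_locally f g) H eps).
  revert H'. apply filter_imp; intros t B. apply B.
Qed.

Definition product_function (w : nat -> C) (alpha beta : nat -> R -> R) (x : R) : C :=
  (RtoC (gauss x) * CSeries (fun r => w r * RtoC (alpha r x)) *
    CSeries (fun s => w s * RtoC (beta s x)))%C.

(** At fixed [x] the coefficients are bounded by [/ gauss x], which is enough
    against a summable [w]. *)
Lemma CSeries_converges (w : nat -> C) (alpha : nat -> R -> R) x :
  ex_series (fun r => Cmod (w r)) ->
  (forall r, Rabs (gauss x * alpha r x) <= 1) ->
  is_series (V := C_R_NormedModule)
    (fun r => w r * RtoC (alpha r x))%C (CSeries (fun r => w r * RtoC (alpha r x))%C).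
Proof.
  intros Hw Ha. apply ex_series_C_bounded with (/ gauss x); [exact Hw|].
  intros r. assert (G := gauss_pos x).
  generalize (Ha r). rewrite Rabs_mult, (Rabs_pos_eq (gauss x)) by lra.
  intros H. apply Rmult_le_reg_l with (gauss x); [exact G|].
  rewrite Rinv_r; lra.
Qed.

Lemma square_sum_product (w : nat -> C) (alpha beta : nat -> R -> R) (k x : R) :
  ex_series (fun r => Cmod (w r)) ->
  (forall r x, Rabs (gauss x * alpha r x) <= 1) ->
  (forall s x, Rabs (beta s x) <= 1) ->
  filterlim (fun N => square_sum (G := C_R_NormedModule)
      (fun r s => w r * w s * RtoC (k * (gauss x * alpha r x * beta s x)))%C N)
    eventually (locally (T := C_R_NormedModule) (RtoC k * product_function w alpha beta x)%C).
Proof.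
  intros w_summable alpha_bound beta_bound.
  unfold product_function.
  replace (RtoC k * _)%C with (RtoC (k * gauss x) *
    (CSeries (fun r => w r * RtoC (alpha r x)) * CSeries (fun s => w s * RtoC (beta s x))))%C
    by (rewrite RtoC_mult; ring).
  eapply filterlim_ext; [|apply square_sum_mult_lim;
    [apply CSeries_converges; auto
    |apply ex_series_C_bounded with 1; auto]].
  intros N; apply sum_n_ext; intros r; apply sum_n_ext; intros s.
  cbv beta. rewrite !RtoC_mult. match goal with |- @eq _ ?a ?b => change (@eq C a b) end. ring.
Qed.

Lemma square_sum_transpose {G : AbelianMonoid} (q : nat -> nat -> G) N :
  square_sum q N = square_sum (fun r s => q s r) N.
Proof. apply sum_n_switch. Qed.

(** Uniform convergence of the integrands in [x] gives the integral [Phi T] of the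
    product over [[0, T]]; uniform convergence of the primitives [J] in [T] allows
    exchanging the limits in [N] and [T].  The limit kernel has [r] and [s]
    exchanged, which the symmetry of [w r * w s] and of the squares undoes.  The sign [sigma]
    is 1 for the pair [cosh], [cos] and -1 for the pair [sinh], [sin]. *)
Lemma self_reciprocal (w : nat -> C) (alpha beta : nat -> R -> R) (sigma y : R)
    (J : nat -> nat -> R -> R) (M : R) :
  ex_series (fun r => Cmod (w r)) ->
  (forall r x, Rabs (gauss x * alpha r x) <= 1) ->
  (forall s x, Rabs (beta s x) <= 1) ->
  (forall r s T,
    is_RInt (fun x => gauss x * alpha r x * beta s x * cos (x * y)) 0 T (J r s T)) ->
  (forall r s T, Rabs (J r s T) <= M) ->
  (forall r s, is_lim (J r s) p_infty
    (sqrt (PI / 2) * (sigma * (gauss y * alpha s y * beta r y)))) ->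
  is_RInt_gen (V := C_R_NormedModule) (cosine_integrand (product_function w alpha beta) y)
    (at_point 0) (Rbar_locally p_infty)
    (RtoC (sqrt (PI / 2)) * (RtoC sigma * product_function w alpha beta y))%C.
Proof.
  intros w_summable alpha_bound beta_bound J_primitive J_bound J_lim.
  set (D := fun (h : nat -> nat -> R) N => square_sum (G := C_R_NormedModule)
              (fun r s => w r * w s * RtoC (h r s))%C N).
  destruct (square_sum_uniform w
    (fun r s x => gauss x * alpha r x * beta s x * cos (x * y)) 1 w_summable) as [g Hg].
  { intros r s x. rewrite !Rabs_mult, <- Rabs_mult.
    assert (A := alpha_bound r x). assert (B := beta_bound s x).
    assert (C := Rabs_le _ _ (COS_bound (x * y))).
    generalize (Rabs_pos (gauss x * alpha r x)) (Rabs_pos (beta s x)) (Rabs_pos (cos (x * y))).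
    intros.
    rewrite <- (Rmult_1_r 1). apply Rmult_le_compat; auto.
    - now apply Rmult_le_pos.
    - rewrite <- (Rmult_1_r 1). now apply Rmult_le_compat. }
  (* The uniform limit of the integrands is identified pointwise, by the product
     of the two series. *)
  assert (Eg : forall x, g x = cosine_integrand (product_function w alpha beta) y x).
  { intros x.
    apply (filterlim_locally_unique (V := C_R_NormedModule) (F := eventually)
      (D (fun r s => gauss x * alpha r x * beta s x * cos (x * y)))).
    - exact (uniform_pointwise eventually _ g Hg x).
    - unfold cosine_integrand. rewrite Cmult_comm.
      eapply filterlim_ext; [|apply (square_sum_product w alpha beta (cos (x * y)) x); auto].
      intros N; apply sum_n_ext; intros r; apply sum_n_ext; intros s.
      cbv beta. now rewrite (Rmult_comm (cos (x * y))). }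
  destruct (square_sum_uniform w J M w_summable J_bound) as [Phi HPhi].
  assert (I : forall T, is_RInt (V := C_R_NormedModule)
      (cosine_integrand (product_function w alpha beta) y) 0 T (Phi T)).
  { intros T.
    destruct (filterlim_RInt (V := C_R_CompleteNormedModule)
      (fun N x => D (fun r s => gauss x * alpha r x * beta s x * cos (x * y)) N) 0 T
      eventually _ g (D (fun r s => J r s T))) as [If [L1 L2]].
    - intros N. unfold D, square_sum.
      apply (is_RInt_sum_n (V := C_R_NormedModule) (fun r x => sum_n (fun s =>
        (w r * w s * RtoC (gauss x * alpha r x * beta s x * cos (x * y)))%C) N)).
      intros r. apply (is_RInt_sum_n (V := C_R_NormedModule) (fun s x =>
        (w r * w s * RtoC (gauss x * alpha r x * beta s x * cos (x * y)))%C)).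
      intros s. apply is_RInt_RtoC, J_primitive.
    - exact Hg.
    - replace (Phi T) with If.
      + apply is_RInt_ext with g; [intros; apply Eg | exact L2].
      + apply (filterlim_locally_unique (V := C_R_NormedModule) (F := eventually) (D (fun r s => J r s T))).
        * exact L1.
        * exact (uniform_pointwise eventually _ Phi HPhi T). }
  (* Exchange of the limits in N and T. *)
  destruct (filterlim_switch (U := C_R_CompleteNormedModule) eventually _
    (Rbar_locally p_infty) _ (fun N T => D (fun r s => J r s T) N) Phi
    (D (fun r s => sqrt (PI / 2) * (sigma * (gauss y * alpha s y * beta r y))))) as [l [L1 L2]].
  { exact HPhi. }
  { intros N. unfold D, square_sum.
    apply (filterlim_sum_n (V := C_R_NormedModule) _ (fun r T => sum_n (fun s =>
        (w r * w s * RtoC (J r s T))%C) N)).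
    intros r. apply (filterlim_sum_n (V := C_R_NormedModule) _ (fun s T =>
        (w r * w s * RtoC (J r s T))%C)).
    intros s. exact (filterlim_RtoC (Rbar_locally p_infty) _ (J r s) _ (J_lim r s)). }
  assert (El : l = (RtoC (sqrt (PI / 2)) * (RtoC sigma * product_function w alpha beta y))%C).
  { apply (filterlim_locally_unique (V := C_R_NormedModule) (F := eventually) _ _ _ L1).
    rewrite Cmult_assoc, <- RtoC_mult.
    eapply filterlim_ext; [|apply (square_sum_product w alpha beta (sqrt (PI / 2) * sigma) y); auto].
    intros N; cbv beta. rewrite square_sum_transpose.
    apply sum_n_ext; intros r; apply sum_n_ext; intros s.
    cbv beta. rewrite (Cmult_comm (w r)). do 2 f_equal. ring. }
  rewrite <- El.
  unfold is_RInt_gen.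
  intros P HP. destruct (L2 P HP) as [A HA].
  exists (fun a => a = 0) (fun T => A < T); [reflexivity | now exists A |].
  intros a T -> HT. exists (Phi T); split; [apply I | now apply HA].
Qed.

(** * The two transforms *)

Lemma cosine_transform_eq (f : R -> C) (y : R) (l : C) :
  is_RInt_gen (V := C_R_NormedModule) (cosine_integrand f y)
    (at_point 0) (Rbar_locally p_infty) (RtoC (sqrt (PI / 2)) * l)%C ->
  ex_cosine_transform f y /\ cosine_transform f y = l.
Proof.
  intros H. split; [eexists; exact H|].
  assert (P := PI_RGT_0).
  unfold cosine_transform.
  rewrite (is_RInt_gen_unique (V := C_R_CompleteNormedModule) _ _ H).
  rewrite Cmult_assoc, <- RtoC_mult, <- sqrt_mult_alt by (apply Rlt_le, Rdiv_lt_0_compat; lra).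
  replace (2 / PI * (PI / 2)) with 1 by (field; lra).
  rewrite sqrt_1. apply Cmult_1_l.
Qed.

Lemma f_of_transform (u : nat -> C) (y : R) :
  ex_series (fun r => Cmod (u r)) ->
  ex_cosine_transform (f_of u) y /\ cosine_transform (f_of u) y = f_of u y.
Proof.
  intros hu. apply cosine_transform_eq.
  replace (f_of u y) with (RtoC 1 * f_of u y)%C by apply Cmult_1_l.
  apply (self_reciprocal u (fun r x => exp (- PI * INR r ^ 2) * cosh (freq r * x))
    (fun s x => cos (freq s * x)) 1 y
    (fun r s => average (cosh_cos_primitive (freq r)) (freq s) y) (2 * sqrt (PI / 2))).
  - exact hu.
  - intros r x. rewrite <- gauss_freq. apply gauss_cosh_bound.
  - intros s x. apply Rabs_le, COS_bound.
  - intros r s T. rewrite <- gauss_freq.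
    apply (is_RInt_average _ _ _ _ (fun x => gauss x * (gauss (freq r) * cosh (freq r * x))) cos).
    + intros z w. rewrite cos_plus, cos_minus; ring.
    + intros c. apply is_RInt_cosh_cos.
  - intros r s T. apply average_bound; intros c. apply cosh_cos_primitive_bound.
  - intros r s. rewrite <- gauss_freq, Rmult_1_l, <- cosh_cos_kernel_value.
    replace (_ * (_ / 2)) with
      ((sqrt (PI / 2) * (gauss (freq s + y) * cos ((freq s + y) * freq r)) +
        sqrt (PI / 2) * (gauss (freq s - y) * cos ((freq s - y) * freq r))) / 2) by field.
    apply (average_lim _ _ _ (fun c => sqrt (PI / 2) * (gauss c * cos (c * freq r)))).
    intros c. apply cosh_cos_primitive_lim.
Qed.

Lemma g_of_transform (u : nat -> C) (y : R) :
  ex_series (fun r => Cmod (u r)) ->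
  ex_cosine_transform (g_of u) y /\ cosine_transform (g_of u) y = Copp (g_of u y).
Proof.
  intros hu. apply cosine_transform_eq.
  replace (Copp (g_of u y)) with (RtoC (-1) * g_of u y)%C 
    by (apply injective_projections; simpl; ring).
  apply (self_reciprocal u (fun r x => exp (- PI * INR r ^ 2) * sinh (freq r * x))
    (fun s x => sin (freq s * x)) (-1) y
    (fun r s => average (sinh_sin_primitive (freq r)) (freq s) y) (2 * sqrt (PI / 2))).
  - exact hu.
  - intros r x. rewrite <- gauss_freq. apply gauss_sinh_bound.
  - intros s x. apply Rabs_le, SIN_bound.
  - intros r s T. rewrite <- gauss_freq.
    apply (is_RInt_average _ _ _ _ (fun x => gauss x * (gauss (freq r) * sinh (freq r * x))) sin).
    + intros z w. rewrite sin_plus, sin_minus; ring.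
    + intros c. apply is_RInt_sinh_sin.
  - intros r s T. apply average_bound; intros c. apply sinh_sin_primitive_bound.
  - intros r s. rewrite <- gauss_freq.
    replace (-1 * (gauss y * (gauss (freq s) * sinh (freq s * y)) * sin (freq r * y)))
      with (- (gauss y * (gauss (freq s) * sinh (freq s * y)) * sin (freq r * y))) by ring.
    rewrite <- sinh_sin_kernel_value.
    replace (_ * (_ / 2)) with
      ((sqrt (PI / 2) * (gauss (freq s + y) * sin ((freq s + y) * freq r)) +
        sqrt (PI / 2) * (gauss (freq s - y) * sin ((freq s - y) * freq r))) / 2) by field.
    apply (average_lim _ _ _ (fun c => sqrt (PI / 2) * (gauss c * sin (c * freq r)))).
    intros c. apply sinh_sin_primitive_lim.
Qed.

Theorem mainTheorem2 (u : nat -> C) (hu : ex_series (fun r => Cmod (u r))) :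
  (forall x : R,
      ex_cosine_transform (f_of u) x /\
      cosine_transform (f_of u) x = f_of u x) /\
  (forall x : R,
      ex_cosine_transform (g_of u) x /\
      cosine_transform (g_of u) x = Copp (g_of u x)).
Proof.
  split; intros x; [now apply f_of_transform | now apply g_of_transform].
Qed.
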